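(* Let $\mathbb K=\mathbb F_q$ be a finite field. Let $L\subset\mathbb Z^r$ be a homogeneous lattice of rank $\ell$ with basis vectors $\mathbf b_1,\dots,\mathbf b_\ell$, and let $B_L$ be the $\ell\times(r+\ell)$ integer matrix with rows $[\,\mathbf b_j\;\;(q-1)\mathbf e_j\,]$, $j=1,\dots,\ell$, where $\mathbf e_j$ is the $j$-th standard basis vector of $\mathbb Z^\ell$. Let $A_L$ be an integer matrix of size $(r+\ell)\times r$ such that $\operatorname{Ker}(B_L)=\operatorname{Im}(A_L)$ (as subgroups of $\mathbb Z^{r+\ell}$), and let $A=[a_{ij}]$ be the $r\times r$ matrix consisting of the first $r$ rows of $A_L$. Then $$V_X(I_L)\cap T_X=\{[t_1^{a_{11}}\cdots t_r^{a_{1r}}:\cdots:t_1^{a_{r1}}\cdots t_r^{a_{rr}}] : t_1,\dots,t_r\in\mathbb K^*\}.$$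
   Context: Setting. $X$ is a complete simplicial toric variety over a field $\mathbb K$ given by a fan $\Sigma\subset\mathbb R^n$ with rays $\rho_1,\dots,\rho_r$ and corresponding primitive lattice generators $\mathbf v_1,\dots,\mathbf v_r\in\mathbb Z^n$. The matrix $\phi:\mathbb Z^n\to\mathbb Z^r$ has rows $\mathbf v_1,\dots,\mathbf v_r$, and there is an exact sequence $0\to\mathbb Z^n\xrightarrow{\phi}\mathbb Z^r\xrightarrow{\beta}\mathcal A\to 0$ with $\mathcal A\cong \mathrm{Cl}(X)$. The Cox ring $S=\mathbb K[x_1,\dots,x_r]$ is graded by $\mathcal A$ via $\deg x_j=\beta_j:=\beta(e_j)$; ''homogeneous'' for polynomials refers to this grading. Let $\mathbf u_1,\dots,\mathbf u_n\in\mathbb Z^r$ be the columns of $\phi$, write $\mathbf t^{\mathbf u}=t_1^{u_1}\cdots t_r^{u_r}$, let $\pi:(\mathbb K^* )^r\to T_X\cong(\mathbb K^* )^n$, $\pi(\mathbf t)=(\mathbf t^{\mathbf u_1},\dots,\mathbf t^{\mathbf u_n})$, and $G=\ker\pi$. The torus $T_X$ is split and $1\to G\to(\mathbb K^* )^r\xrightarrow{\pi}T_X\to1$ is assumed exact, so $T_X=(\mathbb K^* )^r/G$. The irrelevant ideal is $B=\langle \prod_{\rho_i\notin\sigma}x_i : \sigma\in\Sigma\rangle$; the order of the torsion part of $\mathcal A$ is assumed coprime to the characteristic of $\mathbb K$, and points of $X$ are identified with orbits: $X=(\mathbb K^r\setminus V(B))/G$, with $[P]=G\cdot P$. A lattice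 is a subgroup $L\subseteq\mathbb Z^r$; it is homogeneous if $L\subseteq L_\beta:=\operatorname{Ker}\beta=\operatorname{Im}\phi$. Writing $\mathbf m=\mathbf m^+-\mathbf m^-$ with $\mathbf m^{\pm}\in\mathbb N^r$ the positive and negative parts, $I_L=\langle \mathbf x^{\mathbf m^+}-\mathbf x^{\mathbf m^-} : \mathbf m\in L\rangle$. For a homogeneous ideal $J\subseteq S$, $V_X(J)=\{[P]\in X : F(P)=0\text{ for all homogeneous }F\in J\}$. *)

(* Defs.v *)
From HB Require Import structures.
From mathcomp Require Import all_boot all_order all_algebra.
From mathcomp Require Import boolp classical_sets cardinality reals.
From mathcomp Require Import mpoly.
Set Implicit Arguments.
Unset Strict Implicit.
Unset Printing Implicit Defensive.
Import Order.TTheory GRing.Theory Num.Theory.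
Local Open Scope classical_set_scope.
Local Open Scope ring_scope.

Section Fans.
Variables (R : realType) (n : nat).
Implicit Types (sigma tau : set 'rV[R]_n) (Sigma : set (set 'rV[R]_n)).

Definition cone_gen k (w : 'I_k -> 'rV[R]_n) : set 'rV[R]_n :=
  [set x | exists2 c : 'I_k -> R,
             (forall i, 0 <= c i) & x = \sum_(i < k) c i *: w i].

Definition real_vec (v : 'rV[int]_n) : 'rV[R]_n := map_mx intr v.

Definition rational_polyhedral sigma : Prop :=
  exists k (w : 'I_k -> 'rV[int]_n),
    sigma = cone_gen (fun i => real_vec (w i)).

Definition strongly_convex sigma : Prop :=
  forall x, sigma x -> sigma (- x) -> x = 0.

(* Faces are cut out by linear forms u that are nonnegative on sigma;
   u = 0 is allowed, so sigma is a face of itself. *)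
Definition is_face tau sigma : Prop :=
  exists2 u : 'cV[R]_n,
    (forall x, sigma x -> 0 <= (x *m u) 0 0) &
    tau = [set x | sigma x /\ (x *m u) 0 0 = 0].

(* The rows of w are a basis of the linear span of sigma. *)
Definition cone_dim sigma (d : nat) : Prop :=
  exists w : 'M[R]_(d, n),
    [/\ row_free w, (forall i, sigma (row i w)) &
        (forall x, sigma x -> (x <= w)%MS)].

Definition is_fan Sigma : Prop :=
  [/\ finite_set Sigma,
      (forall sigma, Sigma sigma ->
         rational_polyhedral sigma /\ strongly_convex sigma),
      (forall sigma tau, Sigma sigma -> is_face tau sigma -> Sigma tau) &
      (forall sigma tau, Sigma sigma -> Sigma tau ->
         is_face (sigma `&` tau) sigma /\ is_face (sigma `&` tau) tau)].

Definition simplicial_cone sigma : Prop :=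
  exists k (w : 'M[R]_(k, n)),
    row_free w /\ sigma = cone_gen (fun i => row i w).

Definition simplicial_fan Sigma : Prop := Sigma `<=` simplicial_cone.

Definition complete_fan Sigma : Prop :=
  \bigcup_(sigma in Sigma) sigma = [set: 'rV[R]_n].

Definition primitive (v : 'rV[int]_n) : Prop :=
  \big[gcdn/0%N]_(j < n) absz (v 0 j) = 1%N.

Definition ray_cone r (phi : 'M[int]_(r, n)) (i : 'I_r) : set 'rV[R]_n :=
  cone_gen (fun _ : 'I_1 => real_vec (row i phi)).

(* The rows of phi are the primitive generators v_1, ..., v_r of the rays of
   Sigma, each ray being listed exactly once. *)
Definition ray_generators Sigma r (phi : 'M[int]_(r, n)) : Prop :=
  [/\ (forall i, primitive (row i phi)),
      injective (ray_cone phi) &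
      [set ray_cone phi i | i in [set: 'I_r]]
        = [set sigma | Sigma sigma /\ cone_dim sigma 1]].

End Fans.

(* 0 -> Z^n -phi-> Z^r -beta-> cl -> 0 is exact. *)
Definition exact_grading (n r : nat) (phi : 'M[int]_(r, n)) (cl : zmodType)
    (beta : {additive 'cV[int]_r -> cl}) : Prop :=
  [/\ (forall x : 'cV[int]_n, phi *m x = 0 -> x = 0),
      (forall m : 'cV[int]_r, beta m = 0 <-> exists x, m = phi *m x) &
      (forall a : cl, exists m, beta m = a)].

Definition torsion_order (cl : zmodType) (k : nat) : Prop :=
  exists s : seq cl,
    [/\ uniq s,
        (forall a : cl, a \in s <-> exists2 d : nat, (0 < d)%N & a *+ d = 0) &
        size s = k].

Section Polynomials.
Variables (K : fieldType) (r : nat).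

Definition ideal_gen (E : set {mpoly K[r]}) : set {mpoly K[r]} :=
  [set F | exists k (c g : 'I_k -> {mpoly K[r]}),
     (forall i, E (g i)) /\ F = \sum_(i < k) c i * g i].

Definition mon_degree (cl : zmodType) (beta : {additive 'cV[int]_r -> cl})
    (m : 'X_{1..r}) : cl :=
  \sum_(j < r) beta (delta_mx j 0) *+ m j.

Definition homogeneous (cl : zmodType) (beta : {additive 'cV[int]_r -> cl})
    (F : {mpoly K[r]}) : Prop :=
  exists a : cl, forall m, m \in msupp F -> mon_degree beta m = a.

Definition pos_part (m : 'cV[int]_r) : 'X_{1..r} :=
  [multinom absz (Num.max (m i 0) 0)%R | i < r].

Definition neg_part (m : 'cV[int]_r) : 'X_{1..r} := pos_part (- m).

Definition lattice_ideal (L : set 'cV[int]_r) : set {mpoly K[r]} :=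
  ideal_gen [set 'X_[pos_part m] - 'X_[neg_part m] | m in L].

End Polynomials.
Arguments lattice_ideal K [r] L _.

Definition is_lattice r (L : set 'cV[int]_r) : Prop :=
  L 0 /\ forall m m', L m -> L m' -> L (m - m').

Definition homogeneous_lattice r (cl : zmodType)
    (beta : {additive 'cV[int]_r -> cl}) (L : set 'cV[int]_r) : Prop :=
  L `<=` [set m | beta m = 0].

Definition lattice_basis r l (L : set 'cV[int]_r) (b : 'I_l -> 'cV[int]_r)
    : Prop :=
  L = [set m | exists c : 'I_l -> int, m = \sum_(j < l) c j *: b j] /\
  (forall c : 'I_l -> int, \sum_(j < l) c j *: b j = 0 -> forall j, c j = 0).

(* The matrix with rows [b_j, (q-1) e_j]. *)
Definition BL_mx (q r l : nat) (b : 'I_l -> 'cV[int]_r) : 'M[int]_(l, r + l) :=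
  row_mx (\matrix_(j < l, i < r) b j i 0) (q%:Z - 1)%:M.

Definition torus (K : fieldType) (k : nat) : set ('I_k -> K) :=
  [set t | forall i, t i != 0].
Arguments torus : clear implicits.

Definition tmon (K : fieldType) k (t : 'I_k -> K) (u : 'I_k -> int) : K :=
  \prod_(i < k) t i ^ u i.

Section ToricVariety.
Variables (R : realType) (K : fieldType) (n r : nat).
Variables (Sigma : set (set 'rV[R]_n)) (phi : 'M[int]_(r, n)).

Definition torus_map (t : 'I_r -> K) : 'I_n -> K :=
  fun j => tmon t (fun i => phi i j).

Definition G_group : set ('I_r -> K) :=
  [set t | torus K r t /\ torus_map t = (fun=> 1)].

Definition G_orbit (P : 'I_r -> K) : set ('I_r -> K) :=
  [set (fun i => t i * P i) | t in G_group].

Definition irrelevant_ideal : set {mpoly K[r]} :=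
  ideal_gen
    [set \prod_(i < r | ~~ `[< is_face (ray_cone phi i) sigma >]) 'X_i
       | sigma in Sigma].

Definition zero_set (J : set {mpoly K[r]}) : set ('I_r -> K) :=
  [set P | forall F, J F -> F.@[P] = 0].

(* X = (K^r \ V(B)) / G, a point [P] being the orbit G . P as a set. *)
Definition toric_points : set (set ('I_r -> K)) :=
  [set G_orbit P | P in ~` zero_set irrelevant_ideal].

(* T_X = (K^* )^r / G. *)
Definition toric_torus : set (set ('I_r -> K)) :=
  [set G_orbit t | t in torus K r].

(* The vanishing condition does not depend on the representative P, since the
   zero locus of a homogeneous F is stable under G. *)
Definition toric_zero_set (cl : zmodType) (beta : {additive 'cV[int]_r -> cl})
    (J : set {mpoly K[r]}) : set (set ('I_r -> K)) :=
  [set x | toric_points x /\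
     exists2 P, x = G_orbit P &
       forall F, J F -> homogeneous beta F -> F.@[P] = 0].

End ToricVariety.

(* Main.v *)
Require Import Defs.
From HB Require Import structures.
From mathcomp Require Import all_boot all_order all_algebra.
From mathcomp Require Import boolp classical_sets cardinality reals.
From mathcomp Require Import mpoly.
From mathcomp Require Import cyclic finfield.
Set Implicit Arguments.
Unset Strict Implicit.
Unset Printing Implicit Defensive.
Import Order.TTheory GRing.Theory Num.Theory.
Local Open Scope classical_set_scope.
Local Open Scope ring_scope.

(** On the torus, a binomial x^(m+) - x^(m-) vanishes at P exactly when the
    Laurent monomial P^m equals 1.  For m in L this binomial is homogeneous,
    its two terms having degrees that differ by beta(m) = 0, so it is one of
    the equations defining V_X(I_L).  Hence the torus points of V_X(I_L) are
    the orbits of the P in (K^* )^r with P^m = 1 for all m in L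
    ([toric_zero_set_lattice]), and it suffices to test m = b_1, ..., b_l
    ([lattice_tmon1]).

    Over K = F_q these multiplicative equations become linear congruences.
    The group K^* is cyclic of order q - 1; fix a generator e and write
    P_i = e^(y_i) with y in Z^r.  Then P^(b_j) = e^(b_j . y) is 1 if and only
    if b_j . y + (q - 1) z_j = 0 for some integer z_j, so P is a solution if
    and only if y extends to a vector (y, z) of Ker(B_L) = Im(A_L), that is, if
    and only if y = A s for some s in Z^r.  Finally e^(A s) is the monomial
    point with parameters t_j = e^(s_j), and every t in (K^* )^r has this form
    ([lattice_points_parametrized]). *)

(** * Laurent monomials *)

Lemma expfz_sum (K : fieldType) (I : finType) (x : K) (u : I -> int) :
  x != 0 -> x ^ (\sum_i u i) = \prod_i x ^ u i.
Proof.
by move=> x0; elim/big_rec2: _ => // i a c _ <-; rewrite expfzDr.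
Qed.

Lemma expfz_prod (K : fieldType) (I : finType) (x : I -> K) (a : int) :
  (\prod_i x i) ^ a = \prod_i x i ^ a.
Proof.
elim/big_rec2: _ => [|i c d _ <-]; last by rewrite expfzMl.
by rewrite exp1rz.
Qed.

Lemma tmon_lin_comb (K : fieldType) r l (t : 'I_r -> K) (c : 'I_l -> int)
    (b : 'I_l -> 'cV[int]_r) : torus K r t ->
  tmon t (fun i => (\sum_j c j *: b j) i 0)
    = \prod_j tmon t (fun i => b j i 0) ^ c j.
Proof.
move=> t0; under [RHS]eq_bigr => j _ do rewrite /tmon expfz_prod.
rewrite exchange_big /=; apply: eq_bigr => i _.
rewrite summxE expfz_sum //; apply: eq_bigr => j _.
by rewrite mxE mulrC exprz_exp.
Qed.

Lemma lattice_tmon1 (K : fieldType) r l (L : set 'cV[int]_r)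
    (b : 'I_l -> 'cV[int]_r) (t : 'I_r -> K) :
  lattice_basis L b -> torus K r t ->
  (forall m, L m -> tmon t (fun i => m i 0) = 1) <->
  (forall j, tmon t (fun i => b j i 0) = 1).
Proof.
move=> [-> _] t0; split=> [H j|H m [c ->]].
  apply: H; exists (fun i => (i == j)%:R).
  rewrite (bigD1 j) //= eqxx scale1r big1 ?addr0 // => i /negPf ->.
  by rewrite scale0r.
by rewrite tmon_lin_comb // big1 // => j _; rewrite H exp1rz.
Qed.

(** * Discrete logarithms in a finite field *)

Lemma finField_prim_root (K : finFieldType) :
  exists e : K, (#|K|.-1).-primitive_root e.
Proof.
have q1 : (0 < #|K|.-1)%N by have := finNzRing_gt1 K; case: #|K| => [|[]].
have /hasP[e _ ?] : has (#|K|.-1).-primitive_root (enum (predC1 (0 : K))).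
  apply: has_prim_root; rewrite ?enum_uniq -?cardE ?cardC1 //.
  apply/allP => x; rewrite mem_enum inE => x0; apply/unity_rootP.
  apply: (mulfI x0); rewrite mulr1 -exprS prednK ?expf_card //.
  exact: ltnW (finNzRing_gt1 K).
by exists e.
Qed.

Lemma prim_root_neq0 (K : fieldType) n (e : K) :
  n.-primitive_root e -> e != 0.
Proof.
move=> pe; apply/eqP => e0; have := prim_expr_order pe.
have := prim_order_gt0 pe; rewrite e0; case: n {pe} => // n _.
by rewrite exprS mul0r => /esym/eqP; rewrite oner_eq0.
Qed.

Lemma prim_root_expz1 (K : fieldType) n (e : K) (a : int) :
  n.-primitive_root e -> e ^ a = 1 <-> exists z : int, a + n%:Z * z = 0.
Proof.
move=> pe; split=> [ea|[z az]]; last first.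
  have -> : a = n%:Z * - z by rewrite mulrN; apply/eqP; rewrite -addr_eq0 az.
  by rewrite -exprz_exp -exprnP (prim_expr_order pe) exp1rz.
have /dvdzP[z az] : (n %| a)%Z.
  rewrite dvdzE (prim_order_dvd pe).
  by case: a ea => a /eqP //; rewrite NegzE -exprnN invr_eq1.
by exists (- z); rewrite mulrN az mulrC subrr.
Qed.

Lemma torus_log (K : finFieldType) r (e : K) (t : 'I_r -> K) :
  (#|K|.-1).-primitive_root e -> torus K r t ->
  exists y : 'cV[int]_r, t = fun i => e ^ y i 0.
Proof.
move=> pe t0.
have log i : {j : 'I_(#|K|.-1) | t i = e ^+ j}.
  apply: (prim_rootP pe); apply: (mulfI (t0 i)).
  rewrite mulr1 -exprS prednK ?expf_card //; exact: ltnW (finNzRing_gt1 K).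
exists (\col_i (sval (log i) : nat)%:Z); apply/funext => i; rewrite mxE.
exact: svalP (log i).
Qed.

Lemma torus_exp (K : fieldType) r n (e : K) (y : 'cV[int]_r) :
  n.-primitive_root e -> torus K r (fun i => e ^ y i 0).
Proof. by move=> pe i; rewrite expfz_neq0 ?(prim_root_neq0 pe). Qed.

Lemma tmon_exp (K : fieldType) r (e : K) (y : 'cV[int]_r) (u : 'I_r -> int) :
  e != 0 ->
  tmon (fun i => e ^ y i 0) u = e ^ (\sum_i u i * y i 0).
Proof.
move=> e0; rewrite expfz_sum //; apply: eq_bigr => i _.
by rewrite exprz_exp mulrC.
Qed.

Lemma BL_mx_mulE q r l (b : 'I_l -> 'cV[int]_r) (y : 'cV[int]_r)
    (z : 'cV[int]_l) j :
  (BL_mx q b *m col_mx y z) j 0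
    = (\sum_i b j i 0 * y i 0) + (q%:Z - 1) * z j 0.
Proof.
rewrite mul_row_col mxE mul_scalar_mx !mxE; congr (_ + _).
by apply: eq_bigr => i _; rewrite mxE.
Qed.

(** In logarithmic coordinates y, the equations P^(b_j) = 1 say that y is the
    first block of an element of the kernel of B_L. *)
Lemma lattice_points_parametrized (K : finFieldType) r l
    (b : 'I_l -> 'cV[int]_r) p (A_L : 'M[int]_(r + l, p)) (P : 'I_r -> K) :
  (forall z : 'cV[int]_(r + l),
     BL_mx #|K| b *m z = 0 <-> exists s : 'cV[int]_p, z = A_L *m s) ->
  (torus K r P /\ forall j, tmon P (fun i => b j i 0) = 1) <->
  exists2 t, torus K p t & (fun i => tmon t (fun j => usubmx A_L i j)) = P.
Proof.
move=> ker_BL; have [e pe] := finField_prim_root K.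
have e0 := prim_root_neq0 pe.
have qE : #|K|%:Z - 1 = (#|K|.-1)%:Z.
  by rewrite -subn1 subzn // ltnW // finNzRing_gt1.
have AE (s : 'cV[int]_p) i : tmon (fun j => e ^ s j 0) (fun j => usubmx A_L i j)
    = e ^ (usubmx A_L *m s) i 0 by rewrite tmon_exp // mxE.
split=> [[P0 Pb]|[t t0 <-]].
  have [y Py] := torus_log pe P0.
  have /choice[z yz] : forall j, exists z : int,
      \sum_i b j i 0 * y i 0 + (#|K|.-1)%:Z * z = 0.
    by move=> j; apply/(prim_root_expz1 _ pe); rewrite -tmon_exp // -Py.
  have /ker_BL[s sE] : BL_mx #|K| b *m col_mx y (\col_j z j) = 0.
    by apply/colP => j; rewrite BL_mx_mulE qE !mxE yz.
  exists (fun j => e ^ s j 0); first exact: torus_exp pe.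
  by apply/funext => i; rewrite AE mul_usub_mx -sE col_mxKu Py.
have [s ->] := torus_log pe t0; under eq_fun do rewrite AE.
split=> [|j]; first exact: torus_exp pe.
have /ker_BL/colP/(_ j) : exists s', A_L *m s = A_L *m s' by exists s.
rewrite -[A_L *m s]vsubmxK BL_mx_mulE qE -mul_usub_mx [RHS]mxE => ker_s.
rewrite tmon_exp //; apply/(prim_root_expz1 _ pe).
by exists (dsubmx (A_L *m s) j 0).
Qed.

(** * Lattice ideals on the torus *)

Lemma part_diff r (m : 'cV[int]_r) i :
  (pos_part m i)%:Z - (neg_part m i)%:Z = m i 0.
Proof.
rewrite /neg_part !mnmE mxE; case: (lerP (m i 0) 0) => m0.
  by rewrite max_l ?oppr_ge0 // absz0 gez0_abs ?oppr_ge0 // sub0r opprK.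
by rewrite max_r ?oppr_le0 ?ltW // absz0 subr0 gtz0_abs.
Qed.

Lemma meval_lattice_binomial (K : fieldType) r (P : 'I_r -> K)
    (m : 'cV[int]_r) : torus K r P ->
  ('X_[pos_part m] - 'X_[neg_part m]).@[P] = 0
    <-> tmon P (fun i => m i 0) = 1.
Proof.
move=> P0; rewrite mevalB !mevalX.
have -> : tmon P (fun i => m i 0)
    = (\prod_i P i ^+ pos_part m i) / \prod_i P i ^+ neg_part m i.
  rewrite -prodfV -big_split; apply: eq_bigr => i _ /=.
  by rewrite -part_diff expfzDr // exprnN.
have N0 : \prod_i P i ^+ neg_part m i != 0.
  by apply/prodf_neq0 => i _; rewrite expf_neq0.
split=> [/subr0_eq -> |/(canRL (divfK N0)) ->]; first by rewrite divff.
by rewrite mul1r subrr.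
Qed.

Lemma mon_degreeE r (cl : zmodType) (beta : {additive 'cV[int]_r -> cl})
    (m : 'X_{1..r}) : mon_degree beta m = beta (\col_i (m i)%:Z).
Proof.
rewrite /mon_degree [X in beta X]matrix_sum_delta raddf_sum.
by apply: eq_bigr => i _; rewrite big_ord1 mxE -natz scaler_nat raddfMn.
Qed.

Lemma homogeneous_lattice_binomial (K : fieldType) r (cl : zmodType)
    (beta : {additive 'cV[int]_r -> cl}) (m : 'cV[int]_r) : beta m = 0 ->
  homogeneous beta ('X_[pos_part m] - 'X_[neg_part m] : {mpoly K[r]}).
Proof.
move=> bm; exists (mon_degree beta (pos_part m)) => u /msuppB_le.
rewrite !msuppX mem_cat !inE => /orP[/eqP -> //|/eqP ->].
rewrite !mon_degreeE; apply/esym/subr0_eq; rewrite -raddfB -[RHS]bm.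
by congr (beta _); apply/colP => i; rewrite !mxE part_diff.
Qed.

Lemma lattice_ideal_vanish (K : fieldType) r (cl : zmodType)
    (beta : {additive 'cV[int]_r -> cl}) (L : set 'cV[int]_r)
    (P : 'I_r -> K) :
  homogeneous_lattice beta L -> torus K r P ->
  (forall F, lattice_ideal K L F -> homogeneous beta F -> F.@[P] = 0) <->
  (forall m, L m -> tmon P (fun i => m i 0) = 1).
Proof.
move=> hL P0; split=> [H m Lm|H _ [d [c [g [Lg ->]]]] _].
  apply/meval_lattice_binomial => //; apply: H; last first.
    exact/homogeneous_lattice_binomial/hL.
  exists 1%N, (fun=> 1), (fun=> 'X_[pos_part m] - 'X_[neg_part m]).
  by rewrite big_ord1 mul1r; split=> // _; exists m.
rewrite raddf_sum big1 // => i _; have [m Lm <-] := Lg i.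
rewrite /= mevalM; have /(meval_lattice_binomial _ P0) -> := H m Lm.
by rewrite mulr0.
Qed.

(** * Orbits of torus points *)

Lemma G_orbit_refl (K : fieldType) n r (phi : 'M[int]_(r, n)) (P : 'I_r -> K) :
  G_orbit phi P P.
Proof.
exists (fun=> 1); last by apply/funext => i; rewrite mul1r.
split=> [i|]; first exact: oner_neq0.
by apply/funext => j; rewrite /torus_map /tmon big1 // => i _; rewrite exp1rz.
Qed.

Lemma torus_G_orbit (K : fieldType) n r (phi : 'M[int]_(r, n))
    (P Q : 'I_r -> K) : torus K r P -> G_orbit phi P Q -> torus K r Q.
Proof. by move=> P0 [g [g0 _] <-] i; rewrite mulf_neq0. Qed.

(** A complete fan contains some cone, and the monomial generator of the
    irrelevant ideal attached to it has no zero on the torus. *)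
Lemma torus_toric_points (R : realType) (K : fieldType) n r
    (Sigma : set (set 'rV[R]_n)) (phi : 'M[int]_(r, n)) (P : 'I_r -> K) :
  complete_fan Sigma -> torus K r P -> toric_points Sigma phi (G_orbit phi P).
Proof.
move=> cS P0; exists P => // VP.
have [sigma Ssigma _] : (\bigcup_(sigma in Sigma) sigma) 0 by rewrite cS.
pose F : {mpoly K[r]} :=
  \prod_(i < r | ~~ `[< is_face (ray_cone phi i) sigma >]) 'X_i.
suff : F.@[P] != 0.
  rewrite VP ?eqxx //; exists 1%N, (fun=> 1), (fun=> F).
  by rewrite big_ord1 mul1r; split=> // _; exists sigma.
by rewrite rmorph_prod; apply/prodf_neq0 => i _; rewrite /= mevalXU P0.
Qed.

(** A representative on which the homogeneous part of I_L vanishes lies in the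
    torus as soon as its orbit does, so it can be taken as the torus point. *)
Lemma toric_zero_set_lattice (R : realType) (K : fieldType) n r
    (Sigma : set (set 'rV[R]_n)) (phi : 'M[int]_(r, n)) (cl : zmodType)
    (beta : {additive 'cV[int]_r -> cl}) (L : set 'cV[int]_r) :
  complete_fan Sigma -> homogeneous_lattice beta L ->
  toric_zero_set Sigma phi beta (lattice_ideal K L) `&` toric_torus phi
  = [set G_orbit phi P | P in
      [set P | torus K r P /\ forall m, L m -> tmon P (fun i => m i 0) = 1]].
Proof.
move=> cS hL; apply/seteqP; split=> [_ [[_ [P -> VP]] [t t0 tP]]|].
  have P0 : torus K r P.
    by apply: (torus_G_orbit (phi := phi) t0); rewrite tP; apply: G_orbit_refl.
  by exists P => //; split=> //; apply/(lattice_ideal_vanish hL P0).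
move=> _ [P [P0 LP] <-]; split; last by exists P.
split; first exact: torus_toric_points.
by exists P => //; apply/(lattice_ideal_vanish hL P0).
Qed.

Theorem proposition3p4 (R : realType) (K : finFieldType) (n r : nat)
  (Sigma : set (set 'rV[R]_n)) (phi : 'M[int]_(r, n))
  (fan_Sigma : is_fan Sigma)
  (simplicial_Sigma : simplicial_fan Sigma)
  (complete_Sigma : complete_fan Sigma)
  (rays_Sigma : ray_generators Sigma phi)
  (cl : zmodType) (beta : {additive 'cV[int]_r -> cl})
  (exact_beta : exact_grading phi beta)
  (k : nat) (order_torsion : torsion_order cl k)
  (coprime_torsion : forall p, p \in [pchar K] -> coprime k p)
  (exact_pi : torus_map phi @` torus K r = torus K n)
  (L : set 'cV[int]_r)
  (lattice_L : is_lattice L) (homogeneous_L : homogeneous_lattice beta L)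
  (l : nat) (b : 'I_l -> 'cV[int]_r) (basis_b : lattice_basis L b)
  (A_L : 'M[int]_(r + l, r))
  (ker_BL : forall z : 'cV[int]_(r + l),
     BL_mx #|K| b *m z = 0 <-> exists s : 'cV[int]_r, z = A_L *m s) :
  let A : 'M[int]_r := usubmx A_L in
  toric_zero_set Sigma phi beta (lattice_ideal K L)
    `&` toric_torus phi
  = [set G_orbit phi (fun i => tmon t (fun j => A i j)) | t in torus K r].
Proof.
move=> A; rewrite (toric_zero_set_lattice _ _ complete_Sigma homogeneous_L).
have solE P :
    (torus K r P /\ forall m, L m -> tmon P (fun i => m i 0) = 1) <->
    exists2 t, torus K r t & (fun i => tmon t (fun j => A i j)) = P.
  rewrite -(lattice_points_parametrized P ker_BL).
  by split=> -[P0 /(lattice_tmon1 basis_b P0)].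
apply/seteqP; split=> [_ [P /solE[t t0 <-] <-]|_ [t t0 <-]]; first by exists t.
by exists (fun i => tmon t (fun j => A i j)) => //; apply/solE; exists t.
Qed.
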